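(* Let $d\ge1$ and $2+\frac4d<p+1<2^{*}$. Let $\omega>0$ and let $Q_\omega$ be the ground state of the equation $$\Delta Q-\omega Q+|Q|^{p-1}Q=0,\qquad Q\in H^1(\mathbb{R}^d)\setminus\{0\}.$$ Then $Q_\omega$ has two unstable directions in the sense that $Q_\omega\in\overline{PW_+}\cap\overline{PW_-}$, where the closures are taken in $H^1(\mathbb{R}^d)$. In particular, for any $\varepsilon>0$ there exist $f_+\in PW_+$ and $f_-\in PW_-$ such that $$\|Q_\omega-f_{\pm}\|_{H^1}\le\varepsilon .$$
   Context: $2^{*}=\infty$ if $d=1,2$ and $2^{*}=\frac{2d}{d-2}$ if $d\ge3$. For $f\in H^1(\mathbb{R}^d)$ (complex-valued) define $$\mathcal{H}(f)=\|\nabla f\|_{L^2}^2-\frac{2}{p+1}\|f\|_{L^{p+1}}^{p+1},\qquad \mathcal{K}(f)=\|\nabla f\|_{L^2}^2-\frac{d(p-1)}{2(p+1)}\|f\|_{L^{p+1}}^{p+1},$$ $$\mathcal{N}_2(f)=\|f\|_{L^2}^{p+1-\frac d2(p-1)}\|\nabla f\|_{L^2}^{\frac d2(p-1)-2},\qquad N_2=\inf\{\mathcal{N}_2(f): f\in H^1(\mathbb{R}^d)\setminus\{0\},\ \mathcal{K}(f)\le0\},$$ $$\mathcal{B}(f)=\frac{d(p-1)-4}{d(p-1)}\Big(\frac{N_2}{\|f\|_{L^2}^{p+1-\frac d2(p-1)}}\Big)^{\frac{4}{d(p-1)-4}}\quad (f\ne0).$$ $PW=\{f\in H^1(\mathbb{R}^d)\setminus\{0\}:\mathcal{H}(f)<\mathcal{B}(f)\}$,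 $PW_+=\{f\in PW:\mathcal{K}(f)>0\}$, $PW_-=\{f\in PW:\mathcal{K}(f)<0\}$. The action is $\mathcal{S}_\omega(f)=\frac12\|\nabla f\|_{L^2}^2+\frac\omega2\|f\|_{L^2}^2-\frac1{p+1}\|f\|_{L^{p+1}}^{p+1}$. A ground state $Q_\omega$ is a least action solution of the elliptic equation above; it satisfies $\mathcal{S}_\omega(Q_\omega)=\inf\{\mathcal{S}_\omega(Q): Q\in H^1(\mathbb{R}^d)\setminus\{0\},\ \mathcal{K}(Q)=0\}$. It also satisfies $\mathcal{K}(Q_\omega)=0$ and $\mathcal{N}_2(Q_\omega)=N_2$. *)

(* Defs.v *)
From HB Require Import structures.
From mathcomp Require Import all_boot all_order all_algebra.
From mathcomp Require Import complex.
From mathcomp Require Import all_classical all_reals all_analysis.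
From mathcomp Require Import measurable_realfun.
Import Order.TTheory GRing.Theory Num.Theory.
Import numFieldNormedType.Exports.

Set Implicit Arguments.
Unset Strict Implicit.
Unset Printing Implicit Defensive.

Local Open Scope classical_set_scope.
Local Open Scope ring_scope.
Local Open Scope complex_scope.

(* The sigma-algebra on R^n is generated by the coordinate projections; since
   R^n is second countable, it is the Borel sigma-algebra. *)

Definition measure_rV_display : measure_display.
Proof. exact: default_measure_display. Qed.

Section measurable_rV.
Context {R : realType} (n : nat).

Let coord : 'I_n -> 'rV[R]_n -> measurableTypeR R := fun i x => x ord0 i.

Let rV_set0 : g_sigma_preimage coord set0.
Proof. exact: sigma_algebra0. Qed.

Let rV_setC A : g_sigma_preimage coord A -> g_sigma_preimage coord (~` A).
Proof. exact: sigma_algebraC. Qed.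

Let rV_bigcup (F : (set 'rV[R]_n)^nat) : (forall i, g_sigma_preimage coord (F i)) ->
  g_sigma_preimage coord (\bigcup_i (F i)).
Proof. exact: sigma_algebra_bigcup. Qed.

HB.instance Definition _ := @isMeasurable.Build measure_rV_display
  'rV[R]_n (g_sigma_preimage coord) rV_set0 rV_setC rV_bigcup.

Lemma measurable_coord_rV (i : 'I_n) :
  measurable_fun [set: 'rV[R]_n] (fun x => x ord0 i : measurableTypeR R).
Proof.
move=> _ Y mY; rewrite setTI; apply: sub_sigma_algebra => /=.
rewrite -bigcup_seq/=; exists i => /=; first by rewrite mem_index_enum.
by exists Y => //; rewrite setTI.
Qed.

Lemma measurable_fun_rVP d (T : measurableType d) (f : T -> 'rV[R]_n) :
  (forall i, measurable_fun [set: T] (fun t => f t ord0 i : measurableTypeR R)) ->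
  measurable_fun [set: T] f.
Proof.
move=> mf.
suff : g_sigma_preimage (fun i => coord i \o f) `<=` measurable.
  rewrite g_sigma_preimage_comp => pref _ A mA.
  by apply: pref; exists A => //; rewrite setTI.
apply: smallest_sub; first exact: sigma_algebra_measurable.
rewrite -bigcup_seq => A [i _] [B mB <-]; exact: mf.
Qed.

End measurable_rV.

(* Lebesgue measure on R^n: the unit mass on R^0, and on R^(n+1) the image of
   the product measure on R * R^n under (t, v) |-> (t, v_0, ..., v_(n-1)). *)

Section cons_rV.
Context {R : realType} (n : nat).

Definition cons_rV (y : measurableTypeR R * 'rV[R]_n) : 'rV[R]_n.+1 :=
  \row_(i < n.+1) oapp (y.2 ord0) y.1 (unlift ord0 i).

Definition uncons_rV (x : 'rV[R]_n.+1) : measurableTypeR R * 'rV[R]_n :=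
  (x ord0 ord0, \row_(i < n) x ord0 (lift ord0 i)).

Lemma cons_rVK : cancel cons_rV uncons_rV.
Proof.
case=> t v; rewrite /uncons_rV /cons_rV mxE unlift_none /=; congr pair.
by apply/rowP => i; rewrite !mxE liftK.
Qed.

Lemma measurable_cons_rV : measurable_fun [set: _] cons_rV.
Proof.
apply: measurable_fun_rVP => i; case: (unliftP ord0 i) => [j ->|->].
- rewrite (_ : (fun _ => _) = (fun x : 'rV[R]_n => x ord0 j : measurableTypeR R) \o snd).
    by apply: measurableT_comp => //; exact: measurable_coord_rV.
  by apply/funext => y /=; rewrite mxE liftK.
- rewrite (_ : (fun _ => _) = fst); first exact: measurable_fst.
  by apply/funext => y /=; rewrite mxE unlift_none.
Qed.

Lemma measurable_uncons_rV : measurable_fun [set: _] uncons_rV.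
Proof.
apply: measurable_fun_pair; first exact: measurable_coord_rV.
apply: measurable_fun_rVP => i /=.
rewrite (_ : (fun _ => _) = (fun x : 'rV[R]_n.+1 => x ord0 (lift ord0 i) : measurableTypeR R)).
  exact: measurable_coord_rV.
by apply/funext => y /=; rewrite mxE.
Qed.

Variable mu : {sigma_finite_measure set 'rV[R]_n -> \bar R}.

Definition lebesgue_consrV : set 'rV[R]_n.+1 -> \bar R :=
  pushforward (lebesgue_measure \x mu)%E cons_rV.

HB.instance Definition _ := Measure.copy lebesgue_consrV
  (measure_function_pushforward__canonical__measure_function_Measure
    (lebesgue_measure \x mu)%E measurable_cons_rV).

Let lebesgue_consrV_sigma_finite : sigma_finite setT lebesgue_consrV.
Proof.
have /sigma_finiteP[F [TF ndF Foo]] := sigma_finiteT (@lebesgue_measure R).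
have /sigma_finiteP[G [TG ndG Goo]] := sigma_finiteT mu.
exists (fun k => uncons_rV @^-1` (F k `*` G k)).
  apply/esym; rewrite -subTset => x _.
  have [i _ Fi] : (\bigcup_i F i) (uncons_rV x).1 by rewrite -TF.
  have [j _ Gj] : (\bigcup_i G i) (uncons_rV x).2 by rewrite -TG.
  exists (maxn i j) => //; split.
  - by move: Fi; apply/subsetPset/ndF/leq_maxl.
  - by move: Gj; apply/subsetPset/ndG/leq_maxr.
move=> k; have [mF Fk] := Foo k; have [mG Gk] := Goo k; split.
  rewrite -[X in measurable X]setTI.
  by apply: measurable_uncons_rV => //; exact: measurableX.
rewrite /= /lebesgue_consrV /pushforward -comp_preimage.
rewrite (_ : uncons_rV \o cons_rV = id); last first.
  by apply/funext => y; exact: cons_rVK.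
by rewrite preimage_id product_measure1E// lte_mul_pinfty// ge0_fin_numE.
Qed.

HB.instance Definition _ := Measure_isSigmaFinite.Build _ _ _ lebesgue_consrV
  lebesgue_consrV_sigma_finite.

End cons_rV.

Fixpoint lebesgue_rV {R : realType} n : {sigma_finite_measure set 'rV[R]_n -> \bar R} :=
  match n with
  | 0 => \d_(0 : 'rV[R]_0)
  | n'.+1 => lebesgue_consrV (lebesgue_rV n')
  end.

Lemma lebesgue_rV_box {R : realType} n (A : 'I_n -> set (measurableTypeR R)) :
  (forall i, measurable (A i)) ->
  lebesgue_rV n [set x : 'rV[R]_n | forall i, A i (x ord0 i)] =
  (\prod_(i < n) lebesgue_measure (A i))%E.
Proof.
elim: n A => [|n ih] A mA.
  by rewrite big_ord0 /= diracE mem_set//= => i; have := ltn_ord i.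
rewrite big_ord_recl -ih// -product_measure1E//; last first.
  rewrite (_ : [set _ | _] = \bigcap_(i in [set: 'I_n])
      ((fun x : 'rV[R]_n => x ord0 i : measurableTypeR R) @^-1` A (lift ord0 i))).
    apply: fin_bigcap_measurable => // i _.
    by rewrite -[X in measurable X]setTI; exact: measurable_coord_rV.
  by apply/seteqP; split => x /= Ax i *; exact: Ax.
rewrite /= /lebesgue_consrV /pushforward; congr (_ _).
apply/seteqP; split => -[t v] /=.
- move=> Atv; split => [|i].
    by have := Atv ord0; rewrite mxE unlift_none.
  by have := Atv (lift ord0 i); rewrite mxE liftK.
- case=> At Av i; rewrite mxE; by case: (unliftP ord0 i) => [j ->|->] /=.
Qed.

Section test_functions.
Context {R : realType} {d : nat}.
Implicit Types phi : 'rV[R]_d -> R.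

Definition partial (i : 'I_d) phi : 'rV[R]_d -> R :=
  fun x => 'D_(delta_mx ord0 i) phi x.

Definition laplacian phi : 'rV[R]_d -> R :=
  fun x => \sum_(i < d) partial i (partial i phi) x.

Fixpoint Ck (k : nat) phi : Prop :=
  continuous phi /\
  match k with
  | 0 => True
  | k'.+1 => forall i : 'I_d,
      (forall x, derivable phi x (delta_mx ord0 i)) /\ Ck k' (partial i phi)
  end.

Definition test_function phi : Prop :=
  (forall k, Ck k phi) /\ compact (closure [set x | phi x != 0]).

End test_functions.

Section L2.
Context {R : realType} {d : nat}.
Implicit Types f g : 'rV[R]_d -> R[i].

Definition Cintegral f : R[i] :=
  (\int[lebesgue_rV d]_x complex.Re (f x)) +i* (\int[lebesgue_rV d]_x complex.Im (f x)).

Definition modulus f : 'rV[R]_d -> R := fun x => Normc.normc (f x).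

Definition LpnormE (p : R) f : \bar R := 'N[lebesgue_rV d]_(p%:E)[EFin \o modulus f].

(* Real-valued: an infinite norm is sent to 0.  This is harmless below, since
   by the Sobolev embedding every element of H^1 has finite L^q norm for
   2 <= q < 2^*. *)
Definition Lpnorm (p : R) f : R := fine (LpnormE p f).

Definition inL2 f : Prop :=
  [/\ measurable_fun setT (@complex.Re R \o f : _ -> R),
      measurable_fun setT (@complex.Im R \o f : _ -> R) &
      (LpnormE 2 f < +oo)%E].

Definition weak_partial (i : 'I_d) f g : Prop :=
  forall phi : 'rV[R]_d -> R, test_function phi ->
    Cintegral (fun x => f x * (partial i phi x)%:C) =
    - Cintegral (fun x => g x * (phi x)%:C).

End L2.

(* An element of H^1(R^d) is carried by a representative together with
   representatives of its weak partial derivatives.  These are determined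
   almost everywhere, so no quantity below depends on the choice. *)
Record H1 (R : realType) (d : nat) := MkH1 {
  H1fun :> 'rV[R]_d -> R[i];
  H1grad : 'I_d -> 'rV[R]_d -> R[i];
  H1fun_L2 : inL2 H1fun;
  H1grad_L2 : forall i, inL2 (H1grad i);
  H1gradP : forall i, weak_partial i H1fun (H1grad i) }.

Section H1_metric.
Context {R : realType} {d : nat}.
Implicit Types (f g h : H1 R d) (u v w : 'rV[R]_d -> R[i]).

Definition L2norm (u : 'rV[R]_d -> R[i]) : R := Lpnorm 2 u.

Definition L2norm_vec (v : 'I_d -> 'rV[R]_d -> R[i]) : R :=
  Num.sqrt (\sum_(i < d) L2norm (v i) ^+ 2).

Definition H1dist f g : R :=
  Num.sqrt (L2norm (f \- g) ^+ 2 +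
            L2norm_vec (fun i => H1grad f i \- H1grad g i) ^+ 2).

Lemma measurable_modulus u :
  measurable_fun setT (@complex.Re R \o u : _ -> R) -> measurable_fun setT (@complex.Im R \o u : _ -> R) ->
  measurable_fun setT (modulus u).
Proof.
move=> mr mi.
rewrite (_ : modulus u =
    (fun x : R => Num.sqrt x) \o (fun x => (complex.Re (u x)) ^+ 2 + (complex.Im (u x)) ^+ 2)).
  apply: measurableT_comp.
    by apply: continuous_measurable_fun; exact: sqrt_continuous.
  by apply: measurable_funD; apply: measurable_funX.
by apply/funext => x; rewrite /modulus /=; case: (u x).
Qed.

Lemma modulus_ge0 u x : 0 <= modulus u x.
Proof. by rewrite /modulus; case: (u x) => a b; exact: sqrtr_ge0. Qed.

Lemma L2norm_ge0 u : 0 <= L2norm u.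
Proof. exact/fine_ge0/Lnorm_ge0. Qed.

Lemma L2norm0 : L2norm (fun=> 0) = 0.
Proof.
rewrite /L2norm /Lpnorm /LpnormE (_ : EFin \o _ = cst 0%E) ?Lnorm0//.
by apply/funext => x; rewrite /modulus /= expr0n /= addr0 sqrtr0.
Qed.

Lemma L2normBC u v : L2norm (u \- v) = L2norm (v \- u).
Proof.
congr (fine (Lnorm _ _ _)); apply/funext => x /=; congr EFin.
by rewrite /modulus -normcN opprB.
Qed.

Lemma inL2B u v : inL2 u -> inL2 v ->
  inL2 (u \- v) /\ (LpnormE 2 (u \- v)%R <= LpnormE 2 u + LpnormE 2 v)%E.
Proof.
move=> [ru iu fu] [rv iv fv].
have rB : measurable_fun setT (@complex.Re R \o (u \- v) : _ -> R).
  rewrite (_ : _ \o _ = (@complex.Re R \o u) \- (@complex.Re R \o v)); first exact: measurable_funB.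
  by apply/funext => x /=; case: (u x); case: (v x).
have iB : measurable_fun setT (@complex.Im R \o (u \- v) : _ -> R).
  rewrite (_ : _ \o _ = (@complex.Im R \o u) \- (@complex.Im R \o v)); first exact: measurable_funB.
  by apply/funext => x /=; case: (u x); case: (v x).
suff le : (LpnormE 2 (u \- v)%R <= LpnormE 2 u + LpnormE 2 v)%E.
  by split => //; split => //; apply: le_lt_trans le _; rewrite lte_add_pinfty.
have mu := measurable_modulus ru iu; have mv := measurable_modulus rv iv.
have mB := measurable_modulus rB iB.
apply: le_trans (@minkowski_EFin _ _ _ (lebesgue_rV d) _ _ 2 mu mv _); last by rewrite ler1n.
rewrite /LpnormE unlock /=; apply: gt0_ler_poweR.
- by rewrite invr_ge0.
- by rewrite in_itv /= leey andbT integral_ge0.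
- by rewrite in_itv /= leey andbT integral_ge0.
apply: ge0_le_integral => //=.
- apply/measurable_EFinP.
  apply: (measurableT_comp (measurable_powR _)).
  exact: measurableT_comp.
- apply/measurable_EFinP.
  apply: (measurableT_comp (measurable_powR _)).
  apply: measurableT_comp => //; exact: measurable_funD.
move=> x _; rewrite lee_fin.
rewrite !ger0_norm ?addr_ge0 ?modulus_ge0// ge0_ler_powR ?nnegrE ?addr_ge0 ?modulus_ge0//.
by rewrite /modulus -[Normc.normc (v x)]normcN; exact: le_normcD.
Qed.

Lemma L2normB_triangle u v w : inL2 u -> inL2 v -> inL2 w ->
  L2norm (u \- w) <= L2norm (u \- v) + L2norm (v \- w).
Proof.
move=> u2 v2 w2.
have [uv _] := inL2B u2 v2; have [wv _] := inL2B w2 v2.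
have [_] := inL2B uv wv.
rewrite (_ : (u \- v) \- (w \- v) = u \- w); last first.
  by apply/funext => x /=; rewrite opprB addrA subrK.
rewrite [L2norm (v \- w)]L2normBC.
case: uv wv => _ _ uv [_ _ wv] le.
rewrite -fineD ?ge0_fin_numE ?Lnorm_ge0//; apply: fine_le => //.
- rewrite ge0_fin_numE ?Lnorm_ge0//; apply: le_lt_trans le _.
  by rewrite lte_add_pinfty.
- by rewrite fin_numD !ge0_fin_numE ?Lnorm_ge0// uv.
Qed.

Lemma sqrt_triangle (a b x y : R) :
  Num.sqrt ((a + b) ^+ 2 + (x + y) ^+ 2) <=
  Num.sqrt (a ^+ 2 + x ^+ 2) + Num.sqrt (b ^+ 2 + y ^+ 2).
Proof. exact: (le_normcD (a +i* x) (b +i* y)). Qed.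

Lemma sqrt_sum_triangle n (a b : 'I_n -> R) :
  Num.sqrt (\sum_(i < n) (a i + b i) ^+ 2) <=
  Num.sqrt (\sum_(i < n) a i ^+ 2) + Num.sqrt (\sum_(i < n) b i ^+ 2).
Proof.
elim: n a b => [|n ih] a b; first by rewrite !big_ord0 sqrtr0 addr0.
have sum_ge0 c : 0 <= \sum_(i < n) (c i : R) ^+ 2 by apply: sumr_ge0 => i _; exact: sqr_ge0.
rewrite !big_ord_recl; apply: le_trans (le_trans _ (sqrt_triangle (a ord0) (b ord0)
  (Num.sqrt (\sum_(i < n) a (lift ord0 i) ^+ 2))
  (Num.sqrt (\sum_(i < n) b (lift ord0 i) ^+ 2)))) _; last by rewrite !sqr_sqrtr.
rewrite ler_wsqrtr// lerD2l.
rewrite -[leLHS]sqr_sqrtr ?ler_sqr ?nnegrE ?addr_ge0 ?sqrtr_ge0//.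
Qed.

Lemma H1distff f : H1dist f f = 0.
Proof.
have z (u : 'rV[R]_d -> R[i]) : L2norm (u \- u) = 0.
  by rewrite -[RHS]L2norm0; congr L2norm; apply/funext => x /=; rewrite subrr.
rewrite /H1dist /L2norm_vec z expr0n /= add0r big1 ?sqrtr0 ?expr0n ?sqrtr0//.
by move=> i _; rewrite z expr0n.
Qed.

Lemma H1distC f g : H1dist f g = H1dist g f.
Proof.
rewrite /H1dist L2normBC /L2norm_vec.
by under eq_bigr do rewrite L2normBC.
Qed.

Lemma H1dist_triangle f g h : H1dist f h <= H1dist f g + H1dist g h.
Proof.
apply: le_trans (sqrt_triangle _ _ _ _).
have sqrt_ge0 V : 0 <= L2norm_vec V by exact: sqrtr_ge0.
rewrite ler_wsqrtr// lerD// ler_sqr ?nnegrE ?addr_ge0 ?L2norm_ge0//.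
  by apply: L2normB_triangle; exact: H1fun_L2.
apply: le_trans (sqrt_sum_triangle _ _).
rewrite ler_wsqrtr// ler_sum// => i _.
rewrite ler_sqr ?nnegrE ?addr_ge0 ?L2norm_ge0//.
by apply: L2normB_triangle; exact: H1grad_L2.
Qed.

Definition H1ball f (e : R) : set (H1 R d) := [set g | H1dist f g < e].

Definition H1entourage : set_system (H1 R d * H1 R d) := entourage_ H1ball.

Lemma H1ball_center f (e : R) : 0 < e -> H1ball f e f.
Proof. by rewrite /H1ball /= H1distff. Qed.

Lemma H1ball_sym f g (e : R) : H1ball f e g -> H1ball g e f.
Proof. by rewrite /H1ball /= H1distC. Qed.

Lemma H1ball_triangle f g h (e1 e2 : R) :
  H1ball f e1 g -> H1ball g e2 h -> H1ball f (e1 + e2) h.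
Proof.
rewrite /H1ball /= => fg gh.
by apply: le_lt_trans (H1dist_triangle f g h) _; rewrite ltrD.
Qed.

End H1_metric.

(* The topology of the H^1 norm; a pseudometric, since the elements of [H1]
   are representatives. *)
HB.instance Definition _ (R : realType) d := gen_eqMixin (H1 R d).
HB.instance Definition _ (R : realType) d := gen_choiceMixin (H1 R d).
HB.instance Definition _ (R : realType) d :=
  hasNbhs.Build (H1 R d) (nbhs_ (@H1entourage R d)).
HB.instance Definition _ (R : realType) d :=
  @Nbhs_isPseudoMetric.Build R (H1 R d) (@H1entourage R d) erefl (@H1ball R d)
    (@H1ball_center R d) (@H1ball_sym R d) (@H1ball_triangle R d) erefl.

Definition sobolev_exponent (R : realType) (d : nat) : \bar R :=
  if (d <= 2)%N then +oo%E else ((2 * d)%:R / (d - 2)%:R)%:E.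

Section functionals.
Context {R : realType} {d : nat}.
Implicit Types (f g : H1 R d) (p omega : R).

Definition H1nonzero f : Prop := ~ {ae lebesgue_rV d, forall x, f x = 0}.

Definition normgrad f : R := L2norm_vec (H1grad f).

Definition calH p f : R :=
  normgrad f ^+ 2 - 2 / (p + 1) * Lpnorm (p + 1) f `^ (p + 1).

Definition calK p f : R :=
  normgrad f ^+ 2 -
  d%:R * (p - 1) / (2 * (p + 1)) * Lpnorm (p + 1) f `^ (p + 1).

Definition calS p omega f : R :=
  2^-1 * normgrad f ^+ 2 + omega / 2 * L2norm f ^+ 2 -
  (p + 1)^-1 * Lpnorm (p + 1) f `^ (p + 1).

Definition calN2 p f : R :=
  L2norm f `^ (p + 1 - d%:R / 2 * (p - 1)) *
  normgrad f `^ (d%:R / 2 * (p - 1) - 2).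

Definition N2 p : R :=
  inf [set calN2 p f | f in [set f : H1 R d | H1nonzero f /\ calK p f <= 0]].

Definition calB p f : R :=
  (d%:R * (p - 1) - 4) / (d%:R * (p - 1)) *
  (N2 p / L2norm f `^ (p + 1 - d%:R / 2 * (p - 1))) `^
    (4 / (d%:R * (p - 1) - 4)).

Definition PW p : set (H1 R d) :=
  [set f | H1nonzero f /\ calH p f < calB p f].

Definition PWplus p : set (H1 R d) := [set f | PW p f /\ 0 < calK p f].

Definition PWminus p : set (H1 R d) := [set f | PW p f /\ calK p f < 0].

(* The equation Delta Q - omega Q + |Q|^(p-1) Q = 0, in the sense of
   distributions. *)
Definition elliptic_solution p omega (Q : H1 R d) : Prop :=
  H1nonzero Q /\
  forall phi : 'rV[R]_d -> R, test_function phi ->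
    Cintegral (fun x => Q x * (laplacian phi x)%:C)
    - omega%:C * Cintegral (fun x => Q x * (phi x)%:C)
    + Cintegral (fun x => (modulus Q x `^ (p - 1))%:C * Q x * (phi x)%:C) = 0.

Definition ground_state p omega (Q : H1 R d) : Prop :=
  elliptic_solution p omega Q /\
  forall P : H1 R d, elliptic_solution p omega P ->
    calS p omega Q <= calS p omega P.

End functionals.

Arguments N2 {R} d p.

(* Main.v *)
Require Import Defs.
From mathcomp Require Import all_boot all_order all_algebra.
From mathcomp Require Import complex.
From mathcomp Require Import all_classical all_reals all_analysis.
From mathcomp Require Import ring lra measurable_realfun.
Import Order.TTheory GRing.Theory Num.Theory.
Import numFieldNormedType.Exports.

Local Open Scope classical_set_scope.
Local Open Scope ring_scope.

(** The approximating functions are multiples [c Q] of the ground state, with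
    [c < 1] close to 1 for [PWplus] and [c > 1] close to 1 for [PWminus]; clearly
    [c Q] tends to [Q] in H^1 as [c] tends to 1.

    Write [a = d (p - 1) / 2], so that mass-supercriticality says [a > 2], and
    [G = normgrad Q ^+ 2].  The identity [calK p Q = 0] expresses the L^(p+1) norm
    of [Q] through [G], and the identity [calN2 p Q = N2 d p] expresses [N2]
    through [G] and the L^2 norm of [Q].  On the ray through [Q] this gives
    [calK p (c Q) = (c^2 - c^(p+1)) G], whose sign is that of [1 - c], and
      [calH p (c Q) = (c^2 - (2/a) c^(p+1)) G],
      [calB p (c Q) = (1 - 2/a) c^(- 2 (p+1-a) / (a-2)) G].
    The inequality [calH < calB] is therefore the strict weighted AM-GM inequality
      [c^2 < (2/a) c^(p+1) + (1 - 2/a) c^(- 2 (p+1-a) / (a-2))]  for [c != 1]: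
    the weighted mean of the two exponents is exactly 2, which reflects the
    tangency of the graphs of [calH] and [calB] at [c = 1].

    All this needs [G > 0], which follows from the variational
    characterization: if [G = 0], then [calK p (Q/2) = 0] as well, so that [Q/2]
    competes in the minimization of the action, and its action
    [(1/4) calS p omega Q] is smaller than the minimum
    ([action_minimizer_normgrad_gt0]).  This is consistent with the convention that
    reads an infinite L^(p+1) norm as 0, since that convention is homogeneous.

    That [c Q] is again in H^1, with the expected norms, rests on one fact: the
    integral of any function commutes with a positive factor, because it is a
    difference of suprema over simple functions, which can be rescaled
    ([integral_scale]). *)

(** * Homogeneity of the integral *)

Section integral_scaling.
Context (d : measure_display) (T : measurableType d) (R : realType).
Variable mu : {measure set T -> \bar R}.
Local Open Scope ereal_scope.
Import HBNNSimple.

(** Multiplication by [c] is a bijection between the simple functions below [f]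
    and those below [c f], so the two suprema defining the integrals correspond. *)
Lemma ge0_integral_scale (c : R) (f : T -> \bar R) : (0 < c)%R ->
  (forall x, 0 <= f x) -> \int[mu]_x (c%:E * f x) = c%:E * \int[mu]_x f x.
Proof.
move=> c0 f0; have cf0 x : 0 <= c%:E * f x by rewrite mule_ge0// lee_fin ltW.
rewrite !ge0_integralTE// -ereal_supZl ?ltW//; last first.
  by apply/set0P; exists (sintegral mu nnsfun0), nnsfun0.
congr ereal_sup; apply/seteqP; split => [_ [h hf <-]|_ [_ [h hf <-] <-]] /=.
- have ci0 : (0 <= c^-1)%R by rewrite invr_ge0 ltW.
  exists (sintegral mu (scale_nnsfun h ci0)).
    exists (scale_nnsfun h ci0) => //= x.
    by rewrite EFinM lee_pdivrMl.
  rewrite (_ : sintegral mu (scale_nnsfun h ci0) = c^-1%:E * sintegral mu h).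
    by rewrite muleA -EFinM divff ?gt_eqF// mul1e.
  by rewrite -sintegralrM.
- exists (scale_nnsfun h (ltW c0)); last by rewrite -sintegralrM.
  by move=> x /=; rewrite EFinM lee_pmul2l// lte_fin.
Qed.

(** When the positive and the negative part both have infinite integral, their
    difference is [-oo] by convention, and this value too is preserved by [c]. *)
Lemma integral_scale (c : R) (f : T -> \bar R) : (0 < c)%R ->
  \int[mu]_x (c%:E * f x) = c%:E * \int[mu]_x f x.
Proof.
move=> c0; rewrite integralE [in RHS]integralE.
rewrite ge0_funeposM ?ltW// ge0_funenegM ?ltW//.
rewrite ge0_integral_scale// ge0_integral_scale//.
move: (integral mu setT _) (integral mu setT _) => [x| |] [y| |] //=;
  by rewrite -?EFinM -?EFinB ?mulrBr// ?gt0_muley ?gt0_muleNy ?lte_fin//=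
     ?gt0_muley ?gt0_muleNy ?lte_fin.
Qed.

Lemma Rintegral_scale (c : R) (f : T -> R) : (0 < c)%R ->
  (\int[mu]_x (c * f x))%R = (c * \int[mu]_x f x)%R.
Proof.
move=> c0; rewrite /Rintegral.
under eq_integral do rewrite EFinM.
rewrite integral_scale//; case: (integral _ _ _) => [r| |] //=;
 by rewrite ?gt0_muley ?gt0_muleNy ?lte_fin//= mulr0.
Qed.

End integral_scaling.

(** * Scalar multiples in H^1 *)

Section Lp_scaling.
Context {R : realType} {d : nat}.
Local Open Scope complex_scope.
Implicit Types u : 'rV[R]_d -> R[i].

Lemma Cintegral_scale (c : R) u : 0 < c ->
  Cintegral (fun x => c%:C * u x) = c%:C * Cintegral u.
Proof.
move=> c0; rewrite /Cintegral.
rewrite (_ : (fun x => complex.Re _) = (fun x => c * complex.Re (u x))); last first.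
  by apply/funext => x; case: (u x) => a b /=; rewrite mul0r subr0.
rewrite (_ : (fun x => complex.Im _) = (fun x => c * complex.Im (u x))); last first.
  by apply/funext => x; case: (u x) => a b /=; rewrite mul0r addr0.
by rewrite !Rintegral_scale//; simpc.
Qed.

Lemma LpnormE_scale (p : R) (z : R[i]) u : p != 0 ->
  LpnormE p (fun x => z * u x) = ((Normc.normc z)%:E * LpnormE p u)%E.
Proof.
move=> p0; rewrite /LpnormE.
have [->|z0] := eqVneq z 0.
  rewrite Normc.normc0 mul0e -[RHS](@Lnorm0 _ _ _ (lebesgue_rV d) p%:E) ?eqe//.
  by apply: eq_Lnorm => x; rewrite /modulus /= mul0r Normc.normc0.
have nz : 0 < Normc.normc z.
  by have := normr_gt0 z; rewrite z0 normc_def; case: (z) => a b /=; rewrite ltcR.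
rewrite unlock /=.
under eq_integral => x _.
  rewrite /modulus Normc.normcM normrM (gtr0_norm nz) powRM ?normr_ge0 ?ltW// EFinM.
  over.
rewrite integral_scale ?powR_gt0// poweRM ?lee_fin ?powR_ge0 ?integral_ge0//.
by rewrite poweR_EFin -powRrM divff// powRr1// ltW.
Qed.

(** An infinite norm is read as 0 and stays infinite under a nonzero factor, so
    homogeneity survives the passage to real values. *)
Lemma Lpnorm_scale (p : R) (z : R[i]) u : p != 0 ->
  Lpnorm p (fun x => z * u x) = Normc.normc z * Lpnorm p u.
Proof.
move=> p0; rewrite /Lpnorm LpnormE_scale//.
have [/fineK <- //|] := boolP (LpnormE p u \is a fin_num).
rewrite ge0_fin_numE ?Lnorm_ge0// -leNgt leye_eq => /eqP ->.
have : 0 <= Normc.normc z by case: (z) => a b; exact: sqrtr_ge0.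
rewrite le_eqVlt => /predU1P[<-|z0]; first by rewrite mul0e mul0r.
by rewrite gt0_muley ?lte_fin//= mulr0.
Qed.

Lemma normc_real (c : R) : Normc.normc c%:C = `|c|.
Proof. by rewrite /= expr0n /= addr0 sqrtr_sqr. Qed.

Lemma Lpnorm_scale_real (p c : R) u : p != 0 ->
  Lpnorm p (fun x => c%:C * u x) = `|c| * Lpnorm p u.
Proof. by move=> p0; rewrite Lpnorm_scale// normc_real. Qed.

Lemma inL2_scale (c : R) u : inL2 u -> inL2 (fun x => c%:C * u x).
Proof.
move=> [mr mi fu]; split.
- rewrite (_ : _ \o _ = (fun x => c * complex.Re (u x))).
    exact: measurable_funM.
  by apply/funext => x /=; case: (u x) => a b /=; rewrite mul0r subr0.
- rewrite (_ : _ \o _ = (fun x => c * complex.Im (u x))).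
    exact: measurable_funM.
  by apply/funext => x /=; case: (u x) => a b /=; rewrite mul0r addr0.
- rewrite LpnormE_scale//.
  have : LpnormE 2 u \is a fin_num by rewrite ge0_fin_numE// Lnorm_ge0.
  by move=> /fineK <-; rewrite -EFinM ltry.
Qed.

Lemma weak_partial_scale (i : 'I_d) (c : R) u v : 0 < c ->
  weak_partial i u v ->
  weak_partial i (fun x => c%:C * u x) (fun x => c%:C * v x).
Proof.
move=> c0 uv phi tphi.
under [in LHS]eq_fun do rewrite -mulrA.
under [in RHS]eq_fun do rewrite -mulrA.
by rewrite !Cintegral_scale// uv// mulrN.
Qed.

Lemma L2norm_gt0 (f : H1 R d) : H1nonzero f -> 0 < L2norm f.
Proof.
move=> fn0; rewrite lt_neqAle L2norm_ge0 andbT; apply/eqP => f0; apply: fn0.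
have [mr mi ff] := H1fun_L2 f.
have n0 : LpnormE 2 f = 0%E.
  by rewrite -[LHS]fineK ?ge0_fin_numE ?Lnorm_ge0// -[fine _]/(L2norm f) -f0.
have mf : measurable_fun [set: _] (EFin \o modulus f).
  by apply/measurable_EFinP; exact: measurable_modulus.
have two_gt0 : (0 < 2%:E :> \bar R)%E by rewrite lte_fin.
have := @Lnorm_eq0_eq0 _ _ _ (lebesgue_rV d) _ _ mf two_gt0 n0.
by apply: filterS => x /= /(_ I) [/Normc.eq0_normc].
Qed.

Definition scaleH1 (c : R) (c0 : 0 < c) (f : H1 R d) : H1 R d :=
  MkH1 (inL2_scale c f (H1fun_L2 f))
    (fun i => inL2_scale c (H1grad f i) (H1grad_L2 f i))
    (fun i => weak_partial_scale i c f (H1grad f i) c0 (H1gradP f i)).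
#[global] Arguments scaleH1 {c} c0 f.

Section scaleH1_norms.
Variables (c : R) (c0 : 0 < c) (f : H1 R d).

Lemma Lpnorm_scaleH1 (p : R) : p != 0 ->
  Lpnorm p (scaleH1 c0 f) = c * Lpnorm p f.
Proof. by move=> p0; rewrite Lpnorm_scale_real// gtr0_norm. Qed.

Lemma L2norm_vec_scale (k : R) (v : 'I_d -> 'rV[R]_d -> R[i]) :
  L2norm_vec (fun i x => k%:C * v i x) = `|k| * L2norm_vec v.
Proof.
rewrite /L2norm_vec /L2norm.
under eq_bigr do rewrite Lpnorm_scale_real// exprMn.
by rewrite -mulr_sumr sqrtrM ?sqr_ge0// sqrtr_sqr normr_id.
Qed.

Lemma normgrad_scaleH1 : normgrad (scaleH1 c0 f) = c * normgrad f.
Proof. by rewrite /normgrad L2norm_vec_scale gtr0_norm. Qed.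

Lemma H1nonzero_scaleH1 : H1nonzero f -> H1nonzero (scaleH1 c0 f).
Proof.
move=> fn0 cf0; apply: fn0; apply: filterS cf0 => x /= /eqP.
rewrite mulf_eq0 => /orP[|/eqP//].
by rewrite eq_complex /= gt_eqF.
Qed.

Lemma H1dist_scaleH1 :
  H1dist f (scaleH1 c0 f) =
  `|1 - c| * Num.sqrt (L2norm f ^+ 2 + normgrad f ^+ 2).
Proof.
rewrite /H1dist.
have subE (u : 'rV[R]_d -> R[i]) :
    u \- (fun x => c%:C * u x) = (fun x => (1 - c)%:C * u x).
  by apply/funext => x /=; rewrite rmorphB rmorph1 mulrBl mul1r.
rewrite (subE f) [L2norm (fun x => _)]Lpnorm_scale_real//.
rewrite (_ : (fun i => _) = (fun i x => (1 - c)%:C * H1grad f i x)); last first.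
  by apply/funext => i; exact: subE.
rewrite L2norm_vec_scale !exprMn -mulrDr sqrtrM ?sqr_ge0//.
by rewrite sqrtr_sqr normr_id.
Qed.

End scaleH1_norms.
End Lp_scaling.

(** * A strict weighted AM-GM inequality *)

(** With [m] the weighted mean of the exponents, [x^w = x^m e^((w-m) ln x)] lies
    strictly above [x^m (1 + (w-m) ln x)] for [w = u] and [w = v], and the linear
    terms cancel in the weighted sum. *)
Lemma powR_weighted_AMGM {R : realType} (x s t u v : R) :
  0 < x -> x != 1 -> 0 < s -> 0 < t -> s + t = 1 -> u != v ->
  x `^ (s * u + t * v) < s * x `^ u + t * x `^ v.
Proof.
move=> x0 x1 s0 t0 st uv.
have lx : ln x != 0 by rewrite ln_eq0.
have xn0 : x != 0 by rewrite gt_eqF.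
set m := s * u + t * v.
have um : u - m = t * (u - v) by rewrite /m (_ : s = 1 - t); [ring|lra].
have vm : v - m = s * (v - u) by rewrite /m (_ : t = 1 - s); [ring|lra].
have tangent w : w - m != 0 -> x `^ m * (1 + (w - m) * ln x) < x `^ w.
  move=> wm; have -> : x `^ w = x `^ m * expR ((w - m) * ln x).
    by rewrite /powR (negbTE xn0) -expRD; congr expR; ring.
  by rewrite ltr_pM2l ?powR_gt0// expR_gt1Dx// mulf_neq0.
have umn0 : u - m != 0 by rewrite um mulf_eq0 gt_eqF//= subr_eq0.
have vmn0 : v - m != 0 by rewrite vm mulf_eq0 gt_eqF//= subr_eq0 eq_sym.
have -> : x `^ m = s * (x `^ m * (1 + (u - m) * ln x)) +
                   t * (x `^ m * (1 + (v - m) * ln x)).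
  by rewrite um vm (_ : s = 1 - t); [ring|lra].
by rewrite ltrD// ltr_pM2l// tangent.
Qed.

(** * The functionals along the ray through a zero of [calK] *)

Section energy_along_the_ray.
Context {R : realType} {d : nat}.
Variable p : R.
Local Notation a := (d%:R / 2 * (p - 1)).
Local Notation Lp f := (Lpnorm (p + 1) f `^ (p + 1)).
Hypothesis a_gt2 : 2 < a.
Implicit Types f : H1 R d.

Let p_gt1 : 1 < p.
Proof.
have a2 := a_gt2; have : 0 <= d%:R :> R by [].
by have [//|] := ltP 1 p; nra.
Qed.

Let p1_neq0 : p + 1 != 0.
Proof. by have p1 := p_gt1; apply: lt0r_neq0; lra. Qed.

Let pB1_neq0 : p - 1 != 0.
Proof. by rewrite subr_eq0 gt_eqF. Qed.

Let a_neq0 : a != 0.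
Proof. by have a2 := a_gt2; apply: lt0r_neq0; lra. Qed.

Let aB2_neq0 : a - 2 != 0.
Proof. by rewrite subr_eq0 gt_eqF. Qed.

Let d_neq0 : d%:R != 0 :> R.
Proof. by apply: contra_neq a_neq0 => ->; rewrite !mul0r. Qed.

Let da_neq0 : d%:R * (p - 1) - 4 != 0 :> R.
Proof. by have a2 := a_gt2; apply: lt0r_neq0; lra. Qed.

Lemma Lpnorm_ge0 (q : R) (u : 'rV[R]_d -> R[i]) : 0 <= Lpnorm q u.
Proof. exact/fine_ge0/Lnorm_ge0. Qed.

Lemma Lp_powR_scaleH1 (c : R) (c0 : 0 < c) f :
  Lp (scaleH1 c0 f) = c `^ (p + 1) * Lp f.
Proof. by rewrite Lpnorm_scaleH1 ?powRM ?Lpnorm_ge0 ?ltW. Qed.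

Lemma calK0_Lp f : calK p f = 0 -> Lp f = (p + 1) / a * normgrad f ^+ 2.
Proof.
rewrite /calK => /eqP; rewrite subr_eq0 => /eqP ->.
by field; rewrite ?d_neq0 ?p1_neq0 ?pB1_neq0.
Qed.

Lemma calK_scaleH1 (c : R) (c0 : 0 < c) f : calK p f = 0 ->
  calK p (scaleH1 c0 f) = (c ^+ 2 - c `^ (p + 1)) * normgrad f ^+ 2.
Proof.
rewrite /calK normgrad_scaleH1 Lp_powR_scaleH1 => /eqP.
by rewrite subr_eq0 => /eqP Kf; rewrite mulrCA -Kf; ring.
Qed.

Lemma calK_scaleH1_gt0 (c : R) (c0 : 0 < c) f :
  c < 1 -> 0 < normgrad f -> calK p f = 0 -> 0 < calK p (scaleH1 c0 f).
Proof.
move=> c1 g0 Kf; rewrite calK_scaleH1// pmulr_lgt0 ?exprn_gt0// subr_gt0.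
rewrite -powR_mulrn ?(ltW c0)// /powR gt_eqF// ltr_expR ltr_nM2r ?ln_lt0 ?c0//.
by have p1 := p_gt1; lra.
Qed.

Lemma calK_scaleH1_lt0 (c : R) (c0 : 0 < c) f :
  1 < c -> 0 < normgrad f -> calK p f = 0 -> calK p (scaleH1 c0 f) < 0.
Proof.
move=> c1 g0 Kf; rewrite calK_scaleH1// pmulr_llt0 ?exprn_gt0// subr_lt0.
rewrite -powR_mulrn ?(ltW c0)// /powR gt_eqF// ltr_expR ltr_pM2r ?ln_gt0//.
by have p1 := p_gt1; lra.
Qed.

Lemma calH_scaleH1 (c : R) (c0 : 0 < c) f : calK p f = 0 ->
  calH p (scaleH1 c0 f) = (c ^+ 2 - 2 / a * c `^ (p + 1)) * normgrad f ^+ 2.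
Proof.
move=> Kf; rewrite /calH normgrad_scaleH1 Lp_powR_scaleH1 calK0_Lp//.
by field; rewrite ?d_neq0 ?p1_neq0 ?pB1_neq0.
Qed.

(** In [N2 / L2norm (c f) ^ (p+1-a)] the L^2 norm of [f] cancels, and the outer
    exponent [4 / (d (p-1) - 4) = 2 / (a-2)] turns [normgrad f ^ (a-2)] into
    [normgrad f ^ 2]. *)
Lemma calB_scaleH1 (c : R) (c0 : 0 < c) f :
  0 < L2norm f -> calN2 p f = N2 d p ->
  calB p (scaleH1 c0 f) =
  (1 - 2 / a) * c `^ (- (2 * (p + 1 - a) / (a - 2))) * normgrad f ^+ 2.
Proof.
move=> M0 Nf; rewrite /calB -Nf /calN2 /L2norm Lpnorm_scaleH1//.
rewrite -/(L2norm f) (@powRM _ c (L2norm f) _ (ltW c0) (ltW M0)).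
have Mn0 : L2norm f `^ (p + 1 - a) != 0 by rewrite gt_eqF ?powR_gt0.
have cn0 : c `^ (p + 1 - a) != 0 by rewrite gt_eqF ?powR_gt0.
have g0 : 0 <= normgrad f by exact: sqrtr_ge0.
rewrite [X in X `^ (4 / _)](_ : _ = c `^ (- (p + 1 - a)) * normgrad f `^ (a - 2)); last first.
  by rewrite powRN; field; rewrite Mn0 cn0.
rewrite powRM ?powR_ge0// -!powRrM.
rewrite (_ : (a - 2) * _ = 2%:R); last by field; rewrite ?d_neq0 ?da_neq0 ?pB1_neq0.
rewrite powR_mulrn// (_ : - (p + 1 - a) * _ = - (2 * (p + 1 - a) / (a - 2))).
  by rewrite mulrA; congr (_ * _ * _); field; rewrite ?d_neq0 ?da_neq0 ?pB1_neq0.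
by field; rewrite ?d_neq0 ?da_neq0 ?pB1_neq0.
Qed.

(** Strict AM-GM with weights [2/a] and [1 - 2/a]. *)
Lemma scaleH1_PW (c : R) (c0 : 0 < c) f : c != 1 ->
  H1nonzero f -> 0 < normgrad f -> calK p f = 0 -> calN2 p f = N2 d p ->
  PW p (scaleH1 c0 f).
Proof.
move=> c1 fn0 g0 Kf Nf; split; first exact: H1nonzero_scaleH1.
rewrite calH_scaleH1// calB_scaleH1 ?L2norm_gt0// ltr_pM2r ?exprn_gt0//.
rewrite ltrBlDr addrC -powR_mulrn ?ltW//.
have t0 : 0 < 2 / a by rewrite divr_gt0//; have a2 := a_gt2; lra.
have s0 : 0 < 1 - 2 / a by rewrite subr_gt0 ltr_pdivrMr; have a2 := a_gt2; lra.
have uv : p + 1 != - (2 * (p + 1 - a) / (a - 2)).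
  (* The two exponents differ by a (p - 1) / (a - 2). *)
  rewrite -subr_eq0 opprK [eqbLHS](_ : _ = a * (p - 1) / (a - 2)); last by field; rewrite ?d_neq0 ?da_neq0 ?pB1_neq0.
  by rewrite !mulf_neq0 ?invr_eq0.
have st : 2 / a + (1 - 2 / a) = 1 by ring.
have := powR_weighted_AMGM c _ _ _ _ c0 c1 t0 s0 st uv.
rewrite (_ : _ * (p + 1) + _ = 2%:R)//.
by field; rewrite ?d_neq0 ?da_neq0 ?pB1_neq0.
Qed.

(** On [calK p f = 0] the action is
    [(1/2 - 1/a) normgrad f ^ 2 + (omega/2) L2norm f ^ 2]; the lower bound makes
    the infimum of the action over this set a genuine one. *)
Lemma calS_ge0 (omega : R) f : 0 <= omega -> calK p f = 0 -> 0 <= calS p omega f.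
Proof.
move=> w0 Kf; rewrite /calS calK0_Lp//.
have -> : 2^-1 * normgrad f ^+ 2 + omega / 2 * L2norm f ^+ 2 -
    (p + 1)^-1 * ((p + 1) / a * normgrad f ^+ 2) =
    (2^-1 - a^-1) * normgrad f ^+ 2 + omega / 2 * L2norm f ^+ 2.
  by field; rewrite ?d_neq0 ?p1_neq0 ?pB1_neq0.
rewrite addr_ge0// mulr_ge0 ?sqr_ge0 ?divr_ge0//.
by rewrite subr_ge0 lef_pV2 ?posrE; have a2 := a_gt2; lra.
Qed.

(** If the gradient of [f] vanished, all positive multiples of [f] would satisfy
    [calK = 0], and halving [f] would divide its action [(omega/2) L2norm f ^ 2 > 0]
    by 4. *)
Lemma action_minimizer_normgrad_gt0 (omega : R) f : 0 < omega ->
  H1nonzero f -> calK p f = 0 ->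
  calS p omega f =
    inf [set calS p omega g | g in [set g : H1 R d | H1nonzero g /\ calK p g = 0]] ->
  0 < normgrad f.
Proof.
move=> w0 fn0 Kf Smin; rewrite lt_neqAle sqrtr_ge0 andbT; apply/eqP => /esym g0.
have h0 : 0 < 2^-1 :> R by rewrite invr_gt0.
have : calS p omega f <= calS p omega (scaleH1 h0 f).
  rewrite Smin; apply: ge_inf.
    by exists 0 => _ [g [_ Kg] <-]; exact: calS_ge0 (ltW w0) Kg.
  exists (scaleH1 h0 f) => //; split; first exact: H1nonzero_scaleH1.
  by rewrite calK_scaleH1// g0; ring.
rewrite /calS normgrad_scaleH1 Lp_powR_scaleH1 calK0_Lp// g0.
rewrite [L2norm (scaleH1 _ _)]Lpnorm_scaleH1// -/(L2norm f).
have M0 : 0 < omega / 2 * L2norm f ^+ 2.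
  by rewrite mulr_gt0 ?exprn_gt0 ?L2norm_gt0 ?divr_gt0.
have -> : omega / 2 * (2^-1 * L2norm f) ^+ 2 = 4^-1 * (omega / 2 * L2norm f ^+ 2).
  by field.
by move: M0; set X := omega / 2 * _; lra.
Qed.

End energy_along_the_ray.

(** * The ground state lies in both closures *)

Theorem theorem1p3 (R : realType) (d : nat) (p omega : R) (Q : H1 R d)
    (hd : (1 <= d)%N)
    (hp_lower : 2 + 4 / d%:R < p + 1)
    (hp_upper : ((p + 1)%:E < sobolev_exponent R d)%E)
    (homega : 0 < omega)
    (hQ : ground_state p omega Q)
    (* known facts on ground states, recalled with the definition *)
    (hQ_S : calS p omega Q =
      inf [set calS p omega f | f in [set f : H1 R d | H1nonzero f /\ calK p f = 0]])
    (hQ_K : calK p Q = 0)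
    (hQ_N2 : calN2 p Q = N2 d p) :
  (closure (PWplus p) `&` closure (PWminus p)) Q /\
  (forall eps : R, 0 < eps ->
     exists fplus fminus : H1 R d,
       [/\ PWplus p fplus, PWminus p fminus,
           H1dist Q fplus <= eps & H1dist Q fminus <= eps]).
Proof.
have d0 : 0 < d%:R :> R by rewrite ltr0n.
have a2 : 2 < d%:R / 2 * (p - 1).
  have : 4 / d%:R < p - 1 by lra.
  by rewrite ltr_pdivrMr//; lra.
have Qn0 : H1nonzero Q by case: hQ => -[].
have g0 : 0 < normgrad Q.
  exact: (action_minimizer_normgrad_gt0 p a2 _ _ homega Qn0 hQ_K hQ_S).
suff approx (eps : R) : 0 < eps -> exists fplus fminus : H1 R d,
    [/\ PWplus p fplus, PWminus p fminus,
        H1dist Q fplus < eps & H1dist Q fminus < eps].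
  split; last first.
    move=> eps /approx[f [g [Pf Mg df dg]]]; exists f, g.
    by split => //; exact: ltW.
  by split => B /nbhs_ballP[e /= e0 QB];
    have [f [g [Pf Mg df dg]]] := approx _ e0; [exists f|exists g];
    split => //; exact: QB.
move=> eps0.
pose N := Num.sqrt (L2norm Q ^+ 2 + normgrad Q ^+ 2).
have N0 : 0 <= N by exact: sqrtr_ge0.
(* The bound 1/2 keeps 1 - t positive; N + 1 avoids a vanishing denominator. *)
pose t := Num.min (2^-1) (eps / 2 / (N + 1)).
have t0 : 0 < t by rewrite lt_min invr_gt0 ltr0n /= !divr_gt0//; lra.
have t1 : t <= 2^-1 by rewrite ge_min lexx.
have tN : t * N < eps.
  have : t <= eps / 2 / (N + 1) by rewrite ge_min lexx orbT.
  by rewrite ler_pdivlMr; nra.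
have cm0 : 0 < 1 - t by lra.
have cp0 : 0 < 1 + t by lra.
exists (scaleH1 cm0 Q), (scaleH1 cp0 Q); split.
- split; first by apply: scaleH1_PW => //; lra.
  by apply: calK_scaleH1_gt0 => //; lra.
- split; first by apply: scaleH1_PW => //; lra.
  by apply: calK_scaleH1_lt0 => //; lra.
- by rewrite H1dist_scaleH1 -/N opprB addrC subrK ger0_norm ?ltW.
- by rewrite H1dist_scaleH1 -/N opprD addrA subrr sub0r normrN gtr0_norm.
Qed.
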